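(* Let $r\geq 1$ and let $\mathcal{L}_r$ be the set of overpartitions in which the last occurrence of a number may be overlined and there are no $r$ consecutive parts which are all non-overlined. Then $\mathcal{L}_r$ is a separable overpartition class.
   Context: An overpartition (in the ''last occurrence'' convention) is a partition in which the last occurrence of a number may be overlined; parts are listed in non-increasing order of size, with $\overline{t}$ listed after the non-overlined copies of $t$. Consecutiveness refers to positions in this list. For a positive integer $t$ and nonnegative integer $d$, $\overline{t}+d=\overline{t+d}$. A separable overpartition class is a set $\mathcal{P}$ of overpartitions for which there is a subset $\mathcal{B}\subset\mathcal{P}$ (the basis) such that for each $m\geq 1$ the number of overpartitions in $\mathcal{B}$ with $m$ parts is finite, every overpartition in $\mathcal{P}$ with $m$ parts is uniquely of the form $(b_1+\pi_1,\ldots,b_m+\pi_m)$ with $(b_1,\ldots,b_m)\in\mathcal{B}$ and $(\pi_1,\ldots,\pi_m)$ a non-increasing sequence of nonnegative integers, and all overpartitions of this form lie in $\mathcal{P}$. *)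

(* Defs.v *)
From mathcomp Require Import all_boot.
From mathcomp Require Import classical_sets cardinality.

Set Implicit Arguments.
Unset Strict Implicit.
Unset Printing Implicit Defensive.

Local Open Scope classical_set_scope.

(* [(t, false)] is the part t and [(t, true)] is the part \overline{t}. *)
Definition opart : Type := (nat * bool)%type.
Definition psize (x : opart) : nat := x.1.
Definition overlined (x : opart) : bool := x.2.

(* The last conjunct says that only the last occurrence of a number may be
   overlined; together with [sorted] it also forces \overline{t} to be listed
   after the non-overlined copies of t. *)
Definition is_overpartition (s : seq opart) : bool :=
  [&& all (fun x => 0 < psize x) s,
      sorted geq (map psize s)
    & pairwise (fun x y => overlined x ==> (psize y != psize x)) s].

Definition add_opart (x : opart) (d : nat) : opart := (psize x + d, overlined x).

(* (b_1 + pi_1, ..., b_m + pi_m); only used when b and pi have equal sizes. *)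
Definition add_seq (b : seq opart) (pi : seq nat) : seq opart :=
  [seq add_opart x.1 x.2 | x <- zip b pi].

Definition is_basis (B P : set (seq opart)) : Prop :=
  forall m : nat, 1 <= m ->
  [/\ finite_set [set b | B b /\ size b = m],
      forall s, P s -> size s = m ->
        exists! bpi : seq opart * seq nat,
          [/\ B bpi.1, size bpi.1 = m, size bpi.2 = m,
              sorted geq bpi.2 & s = add_seq bpi.1 bpi.2]
    & forall (b : seq opart) (pi : seq nat),
        B b -> size b = m -> size pi = m -> sorted geq pi ->
        P (add_seq b pi)].

Definition separable_overpartition_class (P : set (seq opart)) : Prop :=
  (forall s, P s -> is_overpartition s) /\
  exists B : set (seq opart), B `<=` P /\ is_basis B P.

Definition Lclass (r : nat) : set (seq opart) :=
  [set s | is_overpartition s /\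
     forall v : seq opart, infix v s -> size v = r ->
       ~~ all (fun x => ~~ overlined x) v].

(* Main.v *)
Require Import Defs.
From mathcomp Require Import all_boot.
From mathcomp Require Import classical_sets cardinality.
From mathcomp Require Import zify.

Set Implicit Arguments.
Unset Strict Implicit.
Unset Printing Implicit Defensive.

(** Membership in [Lclass r] of an overpartition depends only on its word of
    overlining flags.  For a given word there is a pointwise least overpartition
    with these flags: its last part has size 1, and sizes grow by one exactly when
    passing an overlined part.  Subtracting it from any overpartition with the
    same flags leaves a non-increasing sequence, so these least overpartitions
    form a basis; there are at most [2 ^ m] of them with [m] parts. *)

(** Merges the order on sizes and the overlining rule: an overlined part must strictly exceed every
    later part. The merged relation is transitive, so only neighbours need to be compared. *)
Definition opart_step (x y : opart) : bool := psize y + overlined x <= psize x.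

Lemma opart_step_trans : transitive opart_step.
Proof. by move=> y x z; rewrite /opart_step; lia. Qed.

Lemma is_overpartitionE s :
  is_overpartition s = all (fun x => 0 < psize x) s && sorted opart_step s.
Proof.
rewrite /is_overpartition; congr (_ && _).
rewrite (sorted_pairwise opart_step_trans) sorted_pairwise; last first.
  by move=> y x z /=; lia.
rewrite pairwise_map -pairwise_relI; apply: eq_pairwise => x y /=.
by rewrite /opart_step; case: (overlined x) => /=; lia.
Qed.

Fixpoint least_overpartition (w : seq bool) : seq opart :=
  if w is f :: w' then
    let b := least_overpartition w' in
    ((if b is x :: _ then psize x + f else 1), f) :: b
  else [::].

Lemma map_overlined_least w : map overlined (least_overpartition w) = w.
Proof. by elim: w => //= f w ->. Qed.

Lemma least_overpartitionP w : is_overpartition (least_overpartition w).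
Proof.
rewrite is_overpartitionE; elim: w => //= f w.
case: (least_overpartition w) => //= y b /andP[/andP[y0 ->] ->].
by rewrite /opart_step /psize /= in y0 *; lia.
Qed.

Lemma map_overlined_add_seq b pi :
  size pi = size b -> map overlined (add_seq b pi) = map overlined b.
Proof. by elim: b pi => [|x b IH] [|p pi] //= [/IH] <-. Qed.

Lemma add_seq_inj b pi1 pi2 : size pi1 = size b -> size pi2 = size b ->
  add_seq b pi1 = add_seq b pi2 -> pi1 = pi2.
Proof.
elim: b pi1 pi2 => [|x b IH] [|p pi1] [|q pi2] //= [s1] [s2] [/addnI -> e].
by rewrite (IH pi1 pi2).
Qed.

(** Adding a non-increasing sequence never shrinks the gap between neighbours, so [opart_step]
    survives. *)
Lemma is_overpartition_add_seq b pi : size pi = size b -> sorted geq pi ->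
  is_overpartition b -> is_overpartition (add_seq b pi).
Proof.
rewrite !is_overpartitionE; elim: b pi => [|x b IH] [|p pi] //= [sz] pathp.
move=> /andP[/andP[x0 posb] pathb].
have /andP[] : all (fun x => 0 < psize x) (add_seq b pi) &&
    sorted opart_step (add_seq b pi).
  by apply: IH; rewrite ?posb ?(path_sorted pathp) ?(path_sorted pathb).
rewrite /add_seq => -> ; rewrite addn_gt0 x0 /=.
case: b pi {IH posb} sz pathp pathb => [|y b] [|q pi] //= _.
move=> /andP[qp _] /andP[xy _] ->; rewrite andbT.
by move: xy; rewrite /opart_step /add_opart /psize /overlined /=; lia.
Qed.

(** Neighbours in the least overpartition differ by exactly the gap that [opart_step] demands. In
    [s] they differ by at least as much, so the differences [pi] do not increase. *)
Lemma overpartition_decomposition s : is_overpartition s ->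
  exists pi, [/\ size pi = size s, sorted geq pi &
    s = add_seq (least_overpartition (map overlined s)) pi].
Proof.
rewrite is_overpartitionE; elim: s => [|x s IH]; first by exists [::].
case: s IH => [_|y s IH] /=.
  rewrite andbT /psize => /andP[x0 _]; exists [:: x.1.-1]; split=> //.
  by rewrite /add_seq /add_opart /= add1n prednK //; case: x x0.
move=> /andP[/and3P[_ y0 ps] /andP[xy pathy]].
have [|pi []] := IH; first by rewrite /= y0 ps pathy.
case: pi => [//|p pi] [sz] pathp /=.
set b := least_overpartition _; set h := (X in (X, overlined y)).
rewrite /add_seq /= => -[ey es].
(* Here [h] is the least size for [y], hence [h + overlined x] is the one for [x]. The subtraction
   does not truncate, since [psize y = h + p] and [psize y + overlined x <= psize x]. *)
exists (psize x - (h + overlined x) :: p :: pi); split=> /=.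
- by rewrite sz.
- rewrite /= in pathp; rewrite pathp andbT.
  by move: xy; rewrite ey /opart_step /add_opart /psize /overlined /=; lia.
rewrite -es -ey; congr (_ :: _); move: xy; rewrite ey /opart_step.
case: x => t f; rewrite /add_opart /psize /overlined /= => xy.
by congr (_, _); rewrite -[X in X + f + _]/h; lia.
Qed.

(** A window of [s] carries the same flags as the window of [t] at the same position, so a fully
    non-overlined one in [s] would give one in [t]. *)
Lemma Lclass_overlined r s t : is_overpartition s ->
  map overlined s = map overlined t -> Lclass r t -> Lclass r s.
Proof.
move=> ops eqst [_ Lt]; split=> // v /infixP[p [q defs]] szv.
pose v' := take (size v) (drop (size p) t).
have ev : map overlined v' = map overlined v.
  rewrite /v' map_take map_drop -eqst defs !map_cat.
  by rewrite drop_size_cat ?size_map // take_size_cat ?size_map.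
have := Lt v'; rewrite -[all _ v'](all_map overlined negb) ev all_map; apply.
  apply/infixP; exists (take (size p) t), (drop (size v) (drop (size p) t)).
  by rewrite !cat_take_drop.
by rewrite -(size_map overlined v') ev size_map.
Qed.

Theorem theorem5p4 (r : nat) (hr : 1 <= r) :
  separable_overpartition_class (Lclass r).
Proof.
split=> [s []//|].
exists [set b | Lclass r b /\ b = least_overpartition (map overlined b)]%classic.
split=> [b []//|m _]; split.
(* Basis elements with [m] parts lie in the image of the finite set of flag words of length [m]. *)
- apply: (@sub_finite_set _ _
    ((fun w : m.-tuple bool => least_overpartition w) @` [set: m.-tuple bool])%classic).
    move=> b [[_ eb] szb].
    have szw : size (map overlined b) == m by rewrite size_map szb.
    by exists (Tuple szw).
  exact/finite_image/finite_finset.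
- move=> s Ls szs; have ops : is_overpartition s by case: Ls.
  have [pi [szpi sorted_pi es]] := overpartition_decomposition ops.
  set b := least_overpartition _ in es.
  have ob : map overlined b = map overlined s by exact: map_overlined_least.
  have szb : size b = m by rewrite -(size_map overlined) ob size_map.
  exists (b, pi); split=> /=.
    split=> //; last by rewrite szpi.
    split; last by rewrite ob.
    by apply: Lclass_overlined ob Ls; exact: least_overpartitionP.
  move=> [b' pi'] /= [[_ eb'] szb' szpi' _ es'].
  (* Adding [pi'] keeps the flags, so [b'] has the flags of [s], and these determine a basis
     element. *)
  have ebb' : b = b'.
    by rewrite eb' /b es' map_overlined_add_seq // szpi'.
  rewrite -ebb' in es' *; congr (_, _).
  by apply: (@add_seq_inj b); rewrite ?szb ?szpi ?szpi' // -es -es'.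
- move=> b pi [Lb _] szb szpi sorted_pi.
  have sz : size pi = size b by rewrite szb.
  apply: Lclass_overlined (map_overlined_add_seq sz) (Lb).
  by apply: is_overpartition_add_seq => //; case: Lb.
Qed.
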